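(* Let $R$ be a unitary ring, let $d\in R$ be regular and let $\overline{d}\in R$ be a generalized inverse of $d$. (i) The following identity holds: $$R^{\parallel d}=\overline{d}(d\overline{d}Rd\overline{d})^{-1}+(1-\overline{d}d)Rd\overline{d}+R(1-d\overline{d}).$$ Moreover, given $x,y\in R$ and $v\in(d\overline{d}Rd\overline{d})^{-1}$, if $w\in d\overline{d}Rd\overline{d}$ is such that $vw=wv=d\overline{d}$, then $$(\overline{d}v)^{\parallel d}=(\overline{d}v+(1-\overline{d}d)xd\overline{d}+y(1-d\overline{d}))^{\parallel d}=wd.$$ (ii) In addition, $$R^{\parallel d}=(\overline{d}dR\overline{d}d)^{-1}\overline{d}+\overline{d}dR(1-d\overline{d})+(1-\overline{d}d)R.$$ Furthermore, given $s,t\in R$ and $z\in(\overline{d}dR\overline{d}d)^{-1}$, if $u\in\overline{d}dR\overline{d}d$ is such that $zu=uz=\overline{d}d$, then $$(z\overline{d})^{\parallel d}=(z\overline{d}+\overline{d}ds(1-d\overline{d})+(1-\overline{d}d)t)^{\parallel d}=du.$$ (iii) In particular, if $p\in R$ is an idempotent with $p\neq 0,1$, then $$R^{\parallel p}=(pRp)^{-1}+pR(1-p)+(1-p)Rp+(1-p)R(1-p),$$ and if $r\in(pRp)^{-1}$, $m\in pR(1-p)+(1-p)Rp+(1-p)R(1-p)$, and $l\in(pRp)^{-1}$ is such that $rl=lr=p$, then $$r^{\parallel p}=(r+m)^{\parallel p}=l.$$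
   Context: $R$ is an associative ring with unit $1$. An element $d$ is regular if there is $z\in R$ with $d=dzd$; any such $z$ is called a generalized (or inner) inverse of $d$. An element $a$ is invertible along $d$ if there is $b\in R$ with $b=bab$, $bR=dR$ and $Rb=Rd$; such $b$ is unique and is denoted $a^{\parallel d}$. $R^{\parallel d}$ denotes the set of all $a\in R$ that are invertible along $d$. For an idempotent $q\in R$, $qRq$ is a ring with unit $q$ and $(qRq)^{-1}$ denotes its set of invertible elements (if $q=0$ this is $\{0\}$). Sums and products of sets are taken elementwise: $A+B=\{\alpha+\beta:\alpha\in A,\beta\in B\}$, $cA=\{c\alpha:\alpha\in A\}$, $Ac=\{\alpha c:\alpha\in A\}$. *)

(* Defs.v *)
From HB Require Import structures.
From mathcomp Require Import all_boot all_algebra.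
From mathcomp Require Import mathcomp_extra boolp classical_sets.

Set Implicit Arguments.
Unset Strict Implicit.
Unset Printing Implicit Defensive.

Import GRing.Theory.
Local Open Scope classical_set_scope.
Local Open Scope ring_scope.

Section Defs.
Variable R : pzRingType.
Implicit Types (a b c d q z : R) (A B : set R).

Definition add_set A B : set R := [set x + y | x in A & y in B].
Definition lmul_set c A : set R := [set c * x | x in A].
Definition rmul_set A c : set R := [set x * c | x in A].

Definition is_gen_inverse d z : Prop := d = d * z * d.
Definition regular d : Prop := exists z, is_gen_inverse d z.

Definition is_inverse_along d a b : Prop :=
  [/\ b = b * a * b,
      lmul_set b [set: R] = lmul_set d [set: R] &
      rmul_set [set: R] b = rmul_set [set: R] d].

Definition invertible_along d : set R :=
  [set a | exists b, is_inverse_along d a b].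

(* Meaningful for a in [invertible_along d] (see [inverse_alongP]); it is 0
   otherwise. *)
Definition inverse_along d a : R := xget 0 [set b | is_inverse_along d a b].

Lemma is_inverse_along_unique d a b b' :
  is_inverse_along d a b -> is_inverse_along d a b' -> b = b'.
Proof.
move=> [bab bR Rb] [bab' bR' Rb'].
have [x _ bx] : lmul_set b' [set: R] b by rewrite bR' -bR; exists 1; rewrite ?mulr1.
have [y _ yb] : rmul_set [set: R] b b' by rewrite Rb -Rb'; exists 1; rewrite ?mul1r.
transitivity (b' * a * b); first by rewrite -bx mulrA -bab'.
by rewrite -yb -2!mulrA [b * _]mulrA -bab.
Qed.

Lemma inverse_alongP d a : invertible_along d a ->
  is_inverse_along d a (inverse_along d a).
Proof. exact: xgetPex. Qed.

Lemma inverse_along_eq d a b : is_inverse_along d a b -> inverse_along d a = b.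
Proof.
by move=> ab; apply: xget_unique => // b' /is_inverse_along_unique; apply.
Qed.

Definition corner q : set R := lmul_set q (rmul_set [set: R] q).
Definition corner_units q : set R :=
  [set v | corner q v /\ exists2 w, corner q w & v * w = q /\ w * v = q].

End Defs.

Arguments add_set {R} A B /.
Arguments lmul_set {R} c A /.
Arguments rmul_set {R} A c /.

Declare Scope elementwise_scope.
Notation "A :+: B" := (add_set A B)
  (at level 50, left associativity) : elementwise_scope.
Notation "c *: A" := (lmul_set c A) : elementwise_scope.
Notation "A :* c" := (rmul_set A c) : elementwise_scope.

(* Main.v *)
Require Import Defs.
From mathcomp Require Import all_boot all_algebra.
From mathcomp Require Import mathcomp_extra boolp classical_sets.

Set Implicit Arguments.
Unset Strict Implicit.
Unset Printing Implicit Defensive.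

Import GRing.Theory.
Local Open Scope classical_set_scope.
Local Open Scope ring_scope.
Local Open Scope elementwise_scope.

(** Put [p = d dbar] and [q = dbar d], two idempotents with [p d = d = d q].
    An inverse [b] of [a] along [d] is the same thing as a solution of
    [d a b = d = b a d] lying in [p R] and in [R q]
    ([is_inverse_along_gen_inverse]). Right multiplication by [dbar] turns
    such a [b] into an inverse of [d a p] in the corner ring [p R p], and
    right multiplication by [d] goes back; left multiplication does the same
    with [q a d] in [q R q]. Hence [a] is invertible along [d] exactly when its
    compression [d a p] (equivalently [q a d]) is a unit of the corner.

    The set identities are then Peirce decompositions. In
    [a = q a p + (1 - q) a p + a (1 - p)] the first term is [dbar (d a p)],
    and the map [a |-> d a p] kills the last two terms, so these can be
    arbitrary and do not influence the inverse. The other identity uses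
    [a = q a p + q a (1 - p) + (1 - q) a] in the same way, and the idempotent
    case is [d = dbar = p]. *)

(** * Peirce decompositions *)

Section IdempotentCorners.
Variables (R : pzRingType) (p : R).
Hypothesis pp : p * p = p.

Lemma cornerP x : corner p x <-> p * x = x /\ x * p = x.
Proof.
split=> [[_ [y _ <-] <-]|[px xp]].
  by rewrite !mulrA pp -!mulrA pp.
by exists x => //; exists x.
Qed.

End IdempotentCorners.

Lemma peirce_left (R : pzRingType) (p q a : R) :
  a = q * a * p + (1 - q) * a * p + a * (1 - p).
Proof. by rewrite -!mulrDl addrC mulrBr mulr1 (addrC q) subrK mul1r subrK. Qed.

Lemma peirce_right (R : pzRingType) (p q a : R) :
  a = q * a * p + q * a * (1 - p) + (1 - q) * a.
Proof. by rewrite -mulrDr (addrC p) subrK mulr1 mulrBl mul1r addrC subrK. Qed.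

Lemma peirce_full (R : pzRingType) (p a : R) :
  a = p * a * p + p * a * (1 - p) + (1 - p) * a * p + (1 - p) * a * (1 - p).
Proof.
rewrite {1}(peirce_right p p a) -[in RHS]addrA; congr (_ + _).
by rewrite -mulrDr (addrC p) subrK mulr1.
Qed.

(** * Inverses along d and units of the corners *)

Section InverseAlong.
Variables (R : pzRingType) (d z : R).
Hypothesis dzd : d * z * d = d.
Let p := d * z.
Let q := z * d.

Let pd : p * d = d. Proof. exact: dzd. Qed.
Let dq : d * q = d. Proof. by rewrite /q mulrA. Qed.
Let pp : p * p = p. Proof. by rewrite /p mulrA dzd. Qed.
Let qq : q * q = q. Proof. by rewrite /q -mulrA dq. Qed.
Let dcp : d * (1 - q) = 0. Proof. by rewrite mulrBr mulr1 dq subrr. Qed.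
Let pcp : (1 - p) * p = 0. Proof. by rewrite mulrBl mul1r pp subrr. Qed.
Let cpd : (1 - p) * d = 0. Proof. by rewrite mulrBl mul1r pd subrr. Qed.
Let qcq : q * (1 - q) = 0. Proof. by rewrite mulrBr mulr1 qq subrr. Qed.

(** The equalities of principal one-sided ideals become equations: [b R = d R]
    splits into [p b = b] and [d = b (a d)], since the idempotent [b a] acts as
    the identity on [b R]. *)
Lemma is_inverse_along_gen_inverse a b :
  is_inverse_along d a b <->
  [/\ d * a * b = d, b * a * d = d, p * b = b & b * q = b].
Proof.
split=> [[bab bR Rb]|[dab bad pb bq]].
  have [x _ dx] : lmul_set d [set: R] b.
    by rewrite -bR; exists 1; rewrite ?mulr1.
  have [y _ yb] : lmul_set b [set: R] d.
    by rewrite bR; exists 1; rewrite ?mulr1.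
  have [x' _ xd] : rmul_set [set: R] d b.
    by rewrite -Rb; exists 1; rewrite ?mul1r.
  have [y' _ by'] : rmul_set [set: R] b d.
    by rewrite Rb; exists 1; rewrite ?mul1r.
  split.
  - by rewrite -{1}by' -!mulrA [b * (a * b)]mulrA -bab.
  - by rewrite -{1}yb mulrA -bab.
  - by rewrite -dx mulrA pd.
  - by rewrite -xd -mulrA dq.
split.
- by rewrite -{3}pb /p !mulrA bad -/p pb.
- apply/seteqP; split=> _ [x _ <-].
    by exists (z * b * x) => //; rewrite !mulrA -/p pb.
  by exists (a * d * x) => //; rewrite !mulrA bad.
- apply/seteqP; split=> _ [x _ <-].
    by exists (x * b * z) => //; rewrite -!mulrA -/q bq.
  by exists (x * d * a) => //; rewrite -!mulrA mulrA -mulrA (mulrA d) dab.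
Qed.

(** With [w] on the left of [d], [p w = w] and [d q = d] give the two membership
    conditions at once, while [d a (w d) = (d a p w) d] and
    [(w d) a d = (w d a p) d] both collapse to [p d = d]. *)
Lemma inverse_along_left_corner a w : corner p w ->
  d * a * p * w = p -> w * (d * a * p) = p -> is_inverse_along d a (w * d).
Proof.
move=> /(cornerP pp _)[pw wp] vw wv.
apply/is_inverse_along_gen_inverse; split.
- by rewrite -{1}pw !mulrA -/p -(mulrA _ d z) -/p vw.
- by rewrite -[X in _ * X = _]pd !mulrA -/p; move: wv; rewrite !mulrA => ->.
- by rewrite mulrA pw.
- by rewrite -mulrA dq.
Qed.

(** The corner inverse is [b z]: [d a p (b z) = (d a b) z = d z] because
    [p b = b], and [(b z) d a p = (b a d) z = d z] because [b q = b]. *)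
Lemma left_corner_unit a :
  invertible_along d a -> corner_units p (d * a * p).
Proof.
move=> [b /is_inverse_along_gen_inverse[dab bad pb bq]]; split.
  by apply/(cornerP pp _); split; [rewrite 2!mulrA pd|rewrite -mulrA pp].
exists (b * z).
  by apply/(cornerP pp _); rewrite mulrA pb /p mulrA -(mulrA b) bq.
split; first by rewrite mulrA -(mulrA _ p) pb dab.
by rewrite !mulrA -(mulrA b) bq bad.
Qed.

(** The mirror image of [inverse_along_left_corner], which is this statement in
    the opposite ring, where [p] and [q] trade places. *)
Lemma inverse_along_right_corner a u : corner q u ->
  q * a * d * u = q -> u * (q * a * d) = q -> is_inverse_along d a (d * u).
Proof.
move=> /(cornerP qq _)[qu uq] vu uv.
apply/is_inverse_along_gen_inverse; split.
- by rewrite -{1}dq -!mulrA; move: vu; rewrite -!mulrA => ->.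
- by rewrite -{1}uq -!mulrA; move: uv; rewrite -!mulrA => ->.
- by rewrite mulrA pd.
- by rewrite -mulrA uq.
Qed.

Lemma right_corner_unit a :
  invertible_along d a -> corner_units q (q * a * d).
Proof.
move=> [b /is_inverse_along_gen_inverse[dab bad pb bq]]; split.
  by apply/(cornerP qq _); split; [rewrite 2!mulrA qq|rewrite -mulrA dq].
exists (z * b).
  apply/(cornerP qq _); split; last by rewrite -mulrA bq.
  by rewrite /q -mulrA (mulrA d) pb.
split; last by rewrite -mulrA 2!(mulrA b) bq bad.
by rewrite -(mulrA _ d) (mulrA d) pb /q -!mulrA (mulrA d) dab.
Qed.

(** Recovers the unit of [p R p] from an element of the sum: [d (1 - q)] and
    [(1 - p) p] vanish, which makes the parameters [x] and [y] free. *)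
Lemma left_compression v x y : corner p v ->
  d * (z * v + (1 - q) * x * p + y * (1 - p)) * p = v.
Proof.
move=> /(cornerP pp _)[pv vp].
rewrite 2!(mulrDr d) 2!(mulrDl _ _ p) -!(mulrA d) -[y * _ * p]mulrA pcp.
by rewrite !mulr0 addr0 !(mulrA d) dcp !mul0r addr0 -/p pv vp.
Qed.

(** Here [q (1 - q)] and [(1 - p) d] vanish instead. *)
Lemma right_compression u s t : corner q u ->
  q * (u * z + q * s * (1 - p) + (1 - q) * t) * d = u.
Proof.
move=> /(cornerP qq _)[qu uq].
rewrite 2!(mulrDr q) 2!(mulrDl _ _ d) (mulrA q (1 - q)) qcq !mul0r addr0.
by rewrite -!(mulrA q) -(mulrA s) cpd !mulr0 addr0 -(mulrA u) uq qu.
Qed.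

End InverseAlong.

(** * Descriptions of the set of elements invertible along d *)

Theorem theorem5p1 (R : pzRingType) :
  (forall d dbar : R, regular d -> is_gen_inverse d dbar ->
    (* (i) *)
    (invertible_along d
       = dbar *: corner_units (d * dbar)
         :+: ((1 - dbar * d) *: [set: R]) :* (d * dbar)
         :+: [set: R] :* (1 - d * dbar)
     /\ forall x y v w : R,
          corner_units (d * dbar) v -> corner (d * dbar) w ->
          v * w = d * dbar -> w * v = d * dbar ->
          inverse_along d (dbar * v)
            = inverse_along d (dbar * v + (1 - dbar * d) * x * (d * dbar)
                               + y * (1 - d * dbar))
          /\ inverse_along d (dbar * v + (1 - dbar * d) * x * (d * dbar)
                              + y * (1 - d * dbar))
            = w * d)
    /\
    (* (ii) *)
    (invertible_along d
       = corner_units (dbar * d) :* dbar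
         :+: ((dbar * d) *: [set: R]) :* (1 - d * dbar)
         :+: (1 - dbar * d) *: [set: R]
     /\ forall s t z u : R,
          corner_units (dbar * d) z -> corner (dbar * d) u ->
          z * u = dbar * d -> u * z = dbar * d ->
          inverse_along d (z * dbar)
            = inverse_along d (z * dbar + dbar * d * s * (1 - d * dbar)
                               + (1 - dbar * d) * t)
          /\ inverse_along d (z * dbar + dbar * d * s * (1 - d * dbar)
                              + (1 - dbar * d) * t)
            = d * u))
  /\
  (* (iii) *)
  (forall p : R, p * p = p -> p <> 0 -> p <> 1 ->
    invertible_along p
      = corner_units p
        :+: (p *: [set: R]) :* (1 - p)
        :+: ((1 - p) *: [set: R]) :* p
        :+: ((1 - p) *: [set: R]) :* (1 - p)
    /\ forall r m l : R,
         corner_units p r ->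
         ((p *: [set: R]) :* (1 - p)
          :+: ((1 - p) *: [set: R]) :* p
          :+: ((1 - p) *: [set: R]) :* (1 - p)) m ->
         corner_units p l -> r * l = p -> l * r = p ->
         inverse_along p r = inverse_along p (r + m)
         /\ inverse_along p (r + m) = l).
Proof.
split=> [d z _ /esym dzd|p pp _ _].
- have pp : d * z * (d * z) = d * z by rewrite mulrA dzd.
  have qq : z * d * (z * d) = z * d by rewrite -!mulrA (mulrA d) dzd.
  split; split.
  + apply/seteqP; split=> [a /(left_corner_unit dzd) vu|].
      exists (z * (d * a * (d * z)) + (1 - z * d) * a * (d * z)).
        exists (z * (d * a * (d * z))); first by exists (d * a * (d * z)).
        exists ((1 - z * d) * a * (d * z)) => //.
        by exists ((1 - z * d) * a) => //; exists a.
      exists (a * (1 - d * z)); first by exists a.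
      by rewrite [RHS](peirce_left (d * z) (z * d)) !mulrA.
    move=> _ [_ [_ [v [cv [w cw [vw wv]]] <-] [_ [_ [x _ <-] <-] <-]]
             [_ [y _ <-] <-]].
    by exists (w * d); apply: (inverse_along_left_corner (z := z)) => //;
      rewrite (left_compression dzd).
  + move=> x y v w [cv _] cw vw wv.
    (* x' = y' = 0 gives the inverse of the first summand alone. *)
    have along x' y' : inverse_along d
        (z * v + (1 - z * d) * x' * (d * z) + y' * (1 - d * z)) = w * d.
      by apply/inverse_along_eq/(inverse_along_left_corner (z := z)) => //;
        rewrite (left_compression dzd).
    by split=> //; rewrite along -(along 0 0) mulr0 !mul0r !addr0.
  + apply/seteqP; split=> [a /(right_corner_unit dzd) vu|].
      exists (z * d * a * d * z + z * d * a * (1 - d * z)).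
        exists (z * d * a * d * z); first by exists (z * d * a * d).
        exists (z * d * a * (1 - d * z)) => //.
        by exists (z * d * a) => //; exists a.
      exists ((1 - z * d) * a); first by exists a.
      by rewrite [RHS](peirce_right (d * z) (z * d)) !mulrA.
    move=> _ [_ [_ [v [cv [u cu [vu uv]]] <-] [_ [_ [s _ <-] <-] <-]]
             [_ [t _ <-] <-]].
    by exists (d * u); apply: (inverse_along_right_corner (z := z)) => //;
      rewrite (right_compression dzd).
  + move=> s t v u [cv _] cu vu uv.
    have along s' t' : inverse_along d
        (v * z + z * d * s' * (1 - d * z) + (1 - z * d) * t') = d * u.
      by apply/inverse_along_eq/(inverse_along_right_corner (z := z)) => //;
        rewrite (right_compression dzd).
    by split=> //; rewrite along -(along 0 0) !mulr0 !mul0r !addr0.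
- have ppp : p * p * p = p by rewrite !pp.
  have pcp : p * (1 - p) = 0 by rewrite mulrBr mulr1 pp subrr.
  have cpp : (1 - p) * p = 0 by rewrite mulrBl mul1r pp subrr.
  (* The three Peirce blocks annihilated by the compression by p. *)
  pose off : set R := (p *: [set: R]) :* (1 - p)
    :+: ((1 - p) *: [set: R]) :* p :+: ((1 - p) *: [set: R]) :* (1 - p).
  have pmp m : off m -> p * m * p = 0.
    move=> [_ [_ [_ [x _ <-] <-] [_ [_ [y _ <-] <-] <-]]
           [_ [_ [t _ <-] <-] <-]].
    rewrite 2!(mulrDr p) 2!(mulrDl _ _ p) -!mulrA cpp !(mulrA p (1 - p)) pcp.
    by rewrite !mul0r !mulr0 !addr0.
  have along r m l : corner p r -> off m -> corner p l ->
      r * l = p -> l * r = p -> is_inverse_along p (r + m) l.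
    move=> /(cornerP pp _)[pr rp] /pmp m0 cl rl lr.
    have [_ lp] := (cornerP pp l).1 cl.
    by rewrite -lp; apply: (inverse_along_left_corner (z := p)); rewrite // pp //
      mulrDr mulrDl m0 addr0 pr rp.
  split.
  + apply/seteqP; split=> [a /(left_corner_unit ppp)|].
      rewrite pp => ru.
      exists (p * a * p + p * a * (1 - p) + (1 - p) * a * p).
        exists (p * a * p + p * a * (1 - p)).
          exists (p * a * p) => //; exists (p * a * (1 - p)) => //.
          by exists (p * a) => //; exists a.
        exists ((1 - p) * a * p) => //.
        by exists ((1 - p) * a) => //; exists a.
      exists ((1 - p) * a * (1 - p)); last by rewrite -peirce_full.
      by exists ((1 - p) * a) => //; exists a.
    move=> _ [_ [_ [r [cr [l cl [rl lr]]] [x xP <-]] [y yP <-]] [t tP <-]].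
    exists l; rewrite -!addrA; apply: along => //.
    by rewrite addrA; exists (x + y) => //; [exists x => //; exists y|exists t].
  + move=> r m l [cr _] mP [cl _] rl lr.
    (* The equality with the inverse of r alone is the case m = 0. *)
    have off0 : off 0.
      have S0 s t : ((s *: [set: R]) :* t) 0.
        by exists 0; [exists 0; rewrite ?mulr0|rewrite mul0r].
      by exists 0; [exists 0; [exact: S0|exists 0; [exact: S0|rewrite addr0]]
        |exists 0; [exact: S0|rewrite addr0]].
    have rml := inverse_along_eq (along r m l cr mP cl rl lr).
    have r0l := inverse_along_eq (along r 0 l cr off0 cl rl lr).
    by split=> //; rewrite rml -r0l addr0.
Qed.
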